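(* Let $P$ be a finite lazy irreducible reversible Markov chain on $\Omega$ with stationary distribution $\pi$. For every weighted routing family with endpoint demand $\kappa:\Omega\times\Omega\to\mathbb R_{\ge0}$ and every $f:\Omega\to\mathbb R$, $$\sum_{I,J\in\Omega}\kappa(I,J)(f(I)-f(J))^2\le\mathcal R_{\mathsf{En}}\,\mathcal E_P(f,f)\le\mathsf{En}_{\max}\,\rho_{\mathrm{supp}}\,\mathcal E_P(f,f).$$
   Context: Lazy means $P(x,x)\ge\frac12$ for all $x$. The undirected transition graph has edge set $\mathcal T=\{\{x,y\}:x\ne y,\ P(x,y)>0\}$; the capacity of $e=\{x,y\}\in\mathcal T$ is $Q(e)=\pi(x)P(x,y)=\pi(y)P(y,x)$. A routing from $I$ to $J$ is a probability distribution $\theta$ on the set of paths from $I$ to $J$ in the transition graph with no repeated vertices (including the empty path when $I=J$). Its transition support is $\operatorname{supp}(\theta)=\{e\in\mathcal T:\Pr_{\gamma\sim\theta}[e\in\gamma]>0\}$ and its energy is $\mathsf{En}(\theta)=\sum_{e\in\mathcal T}\Pr_{\gamma\sim\theta}[e\in\gamma]^2$. Weighted routing family for an endpoint demand $\kappa:\Omega\times\Omega\to\mathbb R_{\ge0}$: a finite set $\mathcal A$, weights $\widehat\kappa(I,a,J)\ge0$ ($I,J\in\Omega$, $a\in\mathcal A$) with $\sum_{a\in\mathcal A}\widehat\kappa(I,a,J)=\kappa(I,J)$, and a routing $\theta_{I,a,J}$ from $I$ to $J$ for each triple $(I,a,J)$ of positive weight. The weights and routings are fixed independently of $f$. Define (sums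 and maxima over triples of positive weight) $\mathsf{En}_{\max}=\max_{\widehat\kappa(I,a,J)>0}\mathsf{En}(\theta_{I,a,J})$, $\rho_{\mathrm{supp}}=\max_{e\in\mathcal T}\frac1{Q(e)}\sum_{I,a,J:\,e\in\operatorname{supp}(\theta_{I,a,J})}\widehat\kappa(I,a,J)$, $\mathcal R_{\mathsf{En}}=\max_{e\in\mathcal T}\frac1{Q(e)}\sum_{I,a,J:\,e\in\operatorname{supp}(\theta_{I,a,J})}\widehat\kappa(I,a,J)\,\mathsf{En}(\theta_{I,a,J})$; all three are zero if the demand is identically zero. The Dirichlet form is $\mathcal E_P(f,f)=\frac12\sum_{x,y}\pi(x)P(x,y)(f(x)-f(y))^2$. *)

(* Defs.v *)
From mathcomp Require Import all_boot all_order all_algebra.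

Set Implicit Arguments.
Unset Strict Implicit.
Unset Printing Implicit Defensive.

Import Order.TTheory GRing.Theory Num.Theory.
Local Open Scope ring_scope.

Definition stochastic (R : realFieldType) (Omega : finType)
    (P : Omega -> Omega -> R) : Prop :=
  (forall x y, 0 <= P x y) /\ (forall x, \sum_y P x y = 1).

Definition probability_vector (R : realFieldType) (T : finType)
    (mu : T -> R) : Prop :=
  (forall x, 0 <= mu x) /\ \sum_x mu x = 1.

Definition stationary_distribution (R : realFieldType) (Omega : finType)
    (P : Omega -> Omega -> R) (pi : Omega -> R) : Prop :=
  probability_vector pi /\ (forall y, \sum_x pi x * P x y = pi y).

Definition reversible (R : realFieldType) (Omega : finType)
    (P : Omega -> Omega -> R) (pi : Omega -> R) : Prop :=
  forall x y, pi x * P x y = pi y * P y x.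

Definition lazy_chain (R : realFieldType) (Omega : finType)
    (P : Omega -> Omega -> R) : Prop :=
  forall x, 2^-1 <= P x x.

Fixpoint nstep (R : realFieldType) (Omega : finType)
    (P : Omega -> Omega -> R) (n : nat) (x y : Omega) : R :=
  if n is m.+1 then \sum_z P x z * nstep P m z y else (x == y)%:R.

Definition irreducible_chain (R : realFieldType) (Omega : finType)
    (P : Omega -> Omega -> R) : Prop :=
  forall x y, exists n, 0 < nstep P n x y.

Definition dirichlet_form (R : realFieldType) (Omega : finType)
    (P : Omega -> Omega -> R) (pi : Omega -> R) (f : Omega -> R) : R :=
  2^-1 * \sum_x \sum_y pi x * P x y * (f x - f y) ^+ 2.

Definition edges (R : realFieldType) (Omega : finType)
    (P : Omega -> Omega -> R) : {set {set Omega}} :=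
  [set [set u.1; u.2] | u in [pred u : Omega * Omega |
                             (u.1 != u.2) && (0 < P u.1 u.2)]].

(* The value is read off an arbitrarily chosen orientation of e; reversibility
   makes the choice irrelevant, see capacityE. *)
Definition capacity (R : realFieldType) (Omega : finType)
    (P : Omega -> Omega -> R) (pi : Omega -> R) (e : {set Omega}) : R :=
  if [pick u : Omega * Omega | (u.1 != u.2) && (e == [set u.1; u.2])]
    is Some u then pi u.1 * P u.1 u.2 else 0.

Lemma capacityE (R : realFieldType) (Omega : finType)
    (P : Omega -> Omega -> R) (pi : Omega -> R) (x y : Omega) :
  reversible P pi -> x != y -> capacity P pi [set x; y] = pi x * P x y.
Proof.
move=> rev xy; rewrite /capacity; case: pickP => [[u v] /= | /(_ (x, y))].
  case/andP=> uv /eqP/setP E.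
  have := E u; have := E v; rewrite !inE !eqxx orbT.
  case/orP=> /eqP vE; case/orP=> /eqP uE; subst u v => //.
  - by rewrite eqxx in uv.
  - by rewrite eqxx in uv.
by rewrite /= xy eqxx.
Qed.

(* A path is the sequence of its vertices; the empty path from I to I is
   [:: I].  Without repetition a path has at most #|Omega| vertices, so bounded
   sequences lose none and form a finType. *)
Notation vseq Omega := (#|{: Omega}|.-bseq Omega).

Definition simple_path (R : realFieldType) (Omega : finType)
    (P : Omega -> Omega -> R) (I J : Omega) (g : seq Omega) : bool :=
  if g is x :: p then
    [&& x == I, last x p == J, uniq g
      & path (fun u v => [set u; v] \in edges P) x p]
  else false.

Definition path_edges (Omega : finType) (g : seq Omega) : seq {set Omega} :=
  if g is x :: p then pairmap (fun u v => [set u; v]) x p else [::].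

Definition routing (R : realFieldType) (Omega : finType)
    (P : Omega -> Omega -> R) (I J : Omega) (theta : vseq Omega -> R) : Prop :=
  probability_vector theta /\
  (forall g : vseq Omega, ~~ simple_path P I J g -> theta g = 0).

Definition edge_prob (R : realFieldType) (Omega : finType)
    (theta : vseq Omega -> R) (e : {set Omega}) : R :=
  \sum_(g : vseq Omega | e \in path_edges g) theta g.

Definition transition_support (R : realFieldType) (Omega : finType)
    (P : Omega -> Omega -> R) (theta : vseq Omega -> R) : {set {set Omega}} :=
  [set e in edges P | 0 < edge_prob theta e].

Definition energy (R : realFieldType) (Omega : finType)
    (P : Omega -> Omega -> R) (theta : vseq Omega -> R) : R :=
  \sum_(e in edges P) edge_prob theta e ^+ 2.

(* theta I a J is unconstrained on the triples of weight 0. *)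
Definition weighted_routing_family (R : realFieldType) (Omega : finType)
    (P : Omega -> Omega -> R) (kappa : Omega -> Omega -> R) (A : finType)
    (khat : Omega -> A -> Omega -> R)
    (theta : Omega -> A -> Omega -> vseq Omega -> R) : Prop :=
  [/\ forall I a J, 0 <= khat I a J,
      forall I J, \sum_a khat I a J = kappa I J
    & forall I a J, 0 < khat I a J -> routing P I J (theta I a J)].

(* All maximised quantities below are nonnegative, so the default value 0 of
   the iterated maximum only matters when the index set is empty. *)
Definition En_max (R : realFieldType) (Omega : finType)
    (P : Omega -> Omega -> R) (A : finType)
    (khat : Omega -> A -> Omega -> R)
    (theta : Omega -> A -> Omega -> vseq Omega -> R) : R :=
  \big[Num.max/0]_I \big[Num.max/0]_a \big[Num.max/0]_(J | 0 < khat I a J)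
    energy P (theta I a J).

Definition rho_supp (R : realFieldType) (Omega : finType)
    (P : Omega -> Omega -> R) (pi : Omega -> R) (A : finType)
    (khat : Omega -> A -> Omega -> R)
    (theta : Omega -> A -> Omega -> vseq Omega -> R) : R :=
  \big[Num.max/0]_(e in edges P)
    ((capacity P pi e)^-1 *
     \sum_I \sum_a
       \sum_(J | (0 < khat I a J) && (e \in transition_support P (theta I a J)))
         khat I a J).

Definition R_En (R : realFieldType) (Omega : finType)
    (P : Omega -> Omega -> R) (pi : Omega -> R) (A : finType)
    (khat : Omega -> A -> Omega -> R)
    (theta : Omega -> A -> Omega -> vseq Omega -> R) : R :=
  \big[Num.max/0]_(e in edges P)
    ((capacity P pi e)^-1 *
     \sum_I \sum_a
       \sum_(J | (0 < khat I a J) && (e \in transition_support P (theta I a J)))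
         khat I a J * energy P (theta I a J)).

(* Main.v *)
(** A path drawn from a routing theta from I to J telescopes f I - f J along its
    (distinct) edges, so |f I - f J| <= \sum_e Pr[e] |grad f e|, and
    Cauchy-Schwarz on supp theta bounds (f I - f J)^2 by the energy of theta
    times the sum of |grad f e|^2 over supp theta.  Weighting by khat and
    exchanging the sums, the coefficient of |grad f e|^2 is at most
    Q(e) R_En, and the Dirichlet form is \sum_e Q(e) |grad f e|^2.  Irreducibility
    ensures pi > 0, hence Q(e) > 0. *)
Require Import Defs.
From mathcomp Require Import all_boot all_order all_algebra.
From mathcomp Require Import ring.
Set Implicit Arguments.
Unset Strict Implicit.
Unset Printing Implicit Defensive.

Import Order.TTheory GRing.Theory Num.Theory.
Local Open Scope ring_scope.

(** Lagrange's identity: the double sum of the squares $(a_i b_j - a_j b_i)^2$ is twice the gap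
    between the two sides. *)
Lemma sum_Cauchy_Schwarz (R : realFieldType) (T : finType) (A : pred T)
    (a b : T -> R) :
  (\sum_(i | A i) a i * b i) ^+ 2
    <= (\sum_(i | A i) a i ^+ 2) * (\sum_(i | A i) b i ^+ 2).
Proof.
have lagrange : 0 <= \sum_(i | A i) \sum_(j | A j) (a i * b j - a j * b i) ^+ 2.
  by apply: sumr_ge0 => i _; apply: sumr_ge0 => j _; apply: sqr_ge0.
suff E : \sum_(i | A i) \sum_(j | A j) (a i * b j - a j * b i) ^+ 2 =
    ((\sum_(i | A i) a i ^+ 2) * (\sum_(i | A i) b i ^+ 2)
     - (\sum_(i | A i) a i * b i) ^+ 2) *+ 2.
  by move: lagrange; rewrite E pmulrn_lge0 // subr_ge0.
have prodE (u v : T -> R) : (\sum_(i | A i) u i) * (\sum_(j | A j) v j) =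
    \sum_(i | A i) \sum_(j | A j) u i * v j.
  by rewrite mulr_suml; apply: eq_bigr => i _; rewrite mulr_sumr.
rewrite mulrnBl mulr2n {2}[_ * _]mulrC expr2 !prodE -sumrMnl -big_split -sumrB.
apply: eq_bigr => i _; rewrite -sumrMnl -big_split -sumrB.
by apply: eq_bigr => j _ /=; ring.
Qed.

Lemma set2_swap (T : finType) (x y a b : T) :
  x != y -> [set x; y] = [set a; b] -> (x, y) = (a, b) \/ (x, y) = (b, a).
Proof.
move=> xy /setP E; have := E x; have := E y; rewrite !inE !eqxx orbT.
case/esym/orP=> /eqP yE; case/esym/orP=> /eqP xE; subst x y;
  by [rewrite eqxx in xy | left | right].
Qed.

Lemma path_edges_sub (T : finType) (g : seq T) (e : {set T}) (z : T) :
  e \in path_edges g -> z \in e -> z \in g.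
Proof.
case: g => [//|x p]; elim: p x => [//|y p IH] x /=.
rewrite inE => /orP[/eqP-> | /IH zp /zp].
  by rewrite !inE => /orP[] ->; rewrite ?orbT.
by rewrite [z \in x :: _]inE => ->; rewrite orbT.
Qed.

(** The first edge contains the first vertex, whereas every later edge has its endpoints among the
    later vertices, which avoid it. *)
Lemma path_edges_uniq (T : finType) (g : seq T) : uniq g -> uniq (path_edges g).
Proof.
case: g => [//|x p]; elim: p x => [//|y p IH] x /= /andP[xyp ypU].
rewrite IH // andbT; apply: contra xyp => /(@path_edges_sub _ (y :: p)).
by apply; rewrite !inE eqxx.
Qed.

Section Gradient.
Context {R : realFieldType} {Omega : finType}.
Implicit Types (P : Omega -> Omega -> R) (pi f : Omega -> R) (e : {set Omega}).

(** Reads off an arbitrary orientation of [e], as [capacity] does; the absolute value makes the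
    choice irrelevant. *)
Definition edge_grad f e : R :=
  if [pick u : Omega * Omega | (u.1 != u.2) && (e == [set u.1; u.2])]
    is Some u then `|f u.1 - f u.2| else 0.

Lemma edge_gradE f x y : x != y -> edge_grad f [set x; y] = `|f x - f y|.
Proof.
move=> xy; rewrite /edge_grad; case: pickP => [[u v] /= | /(_ (x, y))].
  by case/andP=> uv /eqP/(set2_swap xy)[] [-> ->] //; rewrite distrC.
by rewrite /= xy eqxx.
Qed.

Lemma edgesP P e :
  reflect (exists x y, [/\ x != y, 0 < P x y & e = [set x; y]]) (e \in edges P).
Proof.
apply: (iffP imsetP) => [[[x y]] | [x [y [xy Pxy ->]]]].
  by rewrite inE /= => /andP[xy Pxy] ->; exists x, y.
by exists (x, y); rewrite ?inE /= ?xy.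
Qed.

Lemma path_edges_in P I J g e :
  simple_path P I J g -> e \in path_edges g -> e \in edges P.
Proof.
case: g => [//|x p] /and4P[_ _ _]; elim: p x => [//|y p IH] x /= /andP[xy yp].
by rewrite inE => /orP[/eqP-> // | /(IH _ yp)].
Qed.

Lemma simple_path_grad P f I J g :
  simple_path P I J g ->
  `|f I - f J| <= \sum_(e in path_edges g) edge_grad f e.
Proof.
case: g => [//|x p] /and4P[/eqP<- /eqP<- U].
(* The edges are distinct, so the sum over the set of edges is a sum over the list, which allows
   induction along the path. *)
rewrite -big_uniq ?path_edges_uniq // => {U}.
elim: p x => [|y p IH] x /=; first by rewrite subrr normr0 big_nil.
case/andP=> /edgesP[u [v [uv _ E]]] yp; rewrite big_cons.
apply: le_trans (ler_distD (f y) _ _) _; apply: lerD (IH _ yp).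
rewrite E edge_gradE //; have [xy|xy] := eqVneq x y.
  by rewrite xy subrr normr0.
by case: (set2_swap xy E) => [] [-> ->] //; rewrite distrC.
Qed.

Lemma edge_prob_ge0 P I J theta e :
  routing P I J theta -> 0 <= edge_prob theta e.
Proof. by case=> [[t0 _] _]; apply: sumr_ge0. Qed.

Lemma routing_grad P f I J theta :
  routing P I J theta ->
  `|f I - f J| <= \sum_(e in edges P) edge_prob theta e * edge_grad f e.
Proof.
case=> [[t0 t1] tP]; rewrite -[leLHS]mul1r -t1 mulr_suml.
under [leRHS]eq_bigr do rewrite mulr_suml.
(* With the sum over paths outermost, the bound is checked path by path; paths that are not simple
   have mass 0. *)
rewrite (exchange_big_dep predT) //=; apply: ler_sum => g _.
have [gP|/tP->] := boolP (simple_path P I J g); last first.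
  by rewrite mul0r sumr_ge0 // => e _; rewrite mul0r.
rewrite -mulr_sumr; apply: ler_wpM2l => //.
apply: le_trans (simple_path_grad f gP) _.
rewrite [leRHS](eq_bigl (mem (path_edges g))) // => e.
by apply: andb_idl; apply: path_edges_in gP.
Qed.

Lemma routing_energy P f I J theta :
  routing P I J theta ->
  (f I - f J) ^+ 2 <= energy P theta *
    \sum_(e in transition_support P theta) edge_grad f e ^+ 2.
Proof.
move=> rt; pose S := transition_support P theta.
have offS e : e \in edges P -> e \notin S -> edge_prob theta e = 0.
  rewrite inE => -> /=; rewrite -leNgt => p0.
  by apply/eqP; rewrite eq_le p0 (edge_prob_ge0 e rt).
(* Passing to the support before Cauchy-Schwarz leaves the energy unchanged and keeps the gradient
   sum on [S] instead of all of [edges P]. *)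
have toS (F : {set Omega} -> R) :
    (forall e, edge_prob theta e = 0 -> F e = 0) ->
    \sum_(e in edges P) F e = \sum_(e in S) F e.
  move=> F0; rewrite (bigID (mem S)) /= [X in _ + X]big1 => [|e /andP[eE /offS]].
    rewrite addr0; apply: eq_bigl => e.
    by apply: andb_idl; rewrite inE => /andP[].
  by move/(_ eE)/F0.
have grad_le : `|f I - f J| <= \sum_(e in S) edge_prob theta e * edge_grad f e.
  rewrite -toS; first exact: routing_grad.
  by move=> e ->; rewrite mul0r.
rewrite -real_normK ?num_real // /energy toS => [|e ->]; last by rewrite expr0n.
apply: le_trans (sum_Cauchy_Schwarz [in S] (edge_prob theta) (edge_grad f)).
by rewrite lerXn2r ?nnegrE ?(le_trans _ grad_le) ?normr_ge0.
Qed.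

Lemma stationary_nstep P pi n y :
  stationary_distribution P pi -> \sum_x pi x * nstep P n x y = pi y.
Proof.
case=> _ st; elim: n => [|n IH] /= in y *.
  rewrite (bigD1 y) //= eqxx mulr1 big1 ?addr0 // => x /negPf->.
  by rewrite mulr0.
under eq_bigr do rewrite mulr_sumr.
rewrite exchange_big /= -[RHS]IH; apply: eq_bigr => z _.
by rewrite -[in RHS]st mulr_suml; apply: eq_bigr => x _; rewrite mulrA.
Qed.

Lemma nstep_ge0 P n x y : stochastic P -> 0 <= nstep P n x y.
Proof.
case=> P0 _; elim: n x => [|n IH] x /=; first exact: ler0n.
by apply: sumr_ge0 => z _; apply: mulr_ge0.
Qed.

(** Some [x] has positive mass and reaches [y] in some [n] steps; since [pi] is also stationary for
    the [n]-step kernel, [pi y] is at least [pi x * nstep P n x y]. *)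
Lemma stationary_gt0 P pi y :
  stochastic P -> irreducible_chain P -> stationary_distribution P pi ->
  0 < pi y.
Proof.
move=> sP irr st; have [[pi0 pi1] _] := st.
have /existsP[x pix] : [exists x, 0 < pi x].
  apply: contraT; rewrite negb_exists => /forallP pi_le0.
  suff : \sum_x pi x <= 0 by rewrite pi1 ler10.
  by apply: sumr_le0 => x _; rewrite leNgt.
have [n xy] := irr x y; rewrite -(stationary_nstep n y st) (bigD1 x) //=.
apply: ltr_wpDr (mulr_gt0 pix xy).
by apply: sumr_ge0 => z _; apply: mulr_ge0 (pi0 z) (nstep_ge0 _ _ _ sP).
Qed.

Lemma capacity_gt0 P pi e :
  reversible P pi -> (forall x, 0 < pi x) -> e \in edges P ->
  0 < capacity P pi e.
Proof.
move=> rev pi_gt0 /edgesP[x [y [xy Pxy ->]]].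
by rewrite capacityE //; apply: mulr_gt0.
Qed.

(** Each edge collects its two orientations, which contribute equally by reversibility; this absorbs
    the factor 1/2. *)
Lemma dirichlet_form_edges P pi f :
  stochastic P -> reversible P pi -> (forall x, 0 < pi x) ->
  dirichlet_form P pi f =
    \sum_(e in edges P) capacity P pi e * edge_grad f e ^+ 2.
Proof.
move=> [P0 _] rev pi_gt0; rewrite /dirichlet_form pair_big /=.
pose D := [pred u : Omega * Omega | (u.1 != u.2) && (0 < P u.1 u.2)].
rewrite (bigID D) /= [X in _ + X]big1 => [|[x y] /=]; last first.
  rewrite negb_and negbK -leNgt => /orP[/eqP->|Pxy].
    by rewrite subrr expr0n mulr0.
  by have /eqP -> : P x y == 0; rewrite ?mulr0 ?mul0r // eq_le Pxy P0.
rewrite addr0 (partition_big_imset (fun u => [set u.1; u.2])) /= -/(edges P).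
rewrite mulr_sumr; apply: eq_bigr => _ /edgesP[x [y [xy Pxy ->]]].
have Pyx : 0 < P y x.
  by rewrite -(pmulr_rgt0 _ (pi_gt0 y)) -rev mulr_gt0.
have yx : y != x by rewrite eq_sym.
have swap : (y, x) != (x, y) by rewrite xpair_eqE negb_and yx.
(* The fibre over the edge consists of exactly [(x, y)] and [(y, x)]. *)
rewrite (bigD1 (x, y)) /=; last by rewrite unfold_in /= xy Pxy eqxx.
rewrite (bigD1 (y, x)) /=; last by rewrite unfold_in /= yx Pyx setUC eqxx swap.
rewrite big1 => [|[u v] /= /andP[/andP[/andP[/andP[uv _] /eqP/(set2_swap uv)]]]].
  rewrite capacityE // edge_gradE // real_normK ?num_real // -(rev x y).
  by field.
by case=> ->; rewrite eqxx.
Qed.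

End Gradient.

Theorem lemma19 (R : realFieldType) (Omega : finType)
    (P : Omega -> Omega -> R) (pi : Omega -> R)
    (P_stochastic : stochastic P)
    (P_lazy : lazy_chain P)
    (P_irreducible : irreducible_chain P)
    (pi_stationary : stationary_distribution P pi)
    (P_reversible : reversible P pi)
    (kappa : Omega -> Omega -> R)
    (kappa_ge0 : forall I J, 0 <= kappa I J)
    (A : finType)
    (khat : Omega -> A -> Omega -> R)
    (theta : Omega -> A -> Omega -> vseq Omega -> R)
    (family : weighted_routing_family P kappa khat theta)
    (f : Omega -> R) :
  \sum_I \sum_J kappa I J * (f I - f J) ^+ 2
    <= R_En P pi khat theta * dirichlet_form P pi f
    <= En_max P khat theta * rho_supp P pi khat theta * dirichlet_form P pi f.
Proof.
have pi_gt0 x : 0 < pi x by apply: stationary_gt0 pi_stationary.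
have Q_gt0 e : e \in edges P -> 0 < capacity P pi e by apply: capacity_gt0.
have [khat_ge0 khat_sum rt] := family.
rewrite dirichlet_form_edges //; apply/andP; split.
  (* First inequality: [load e] is the coefficient of the squared gradient at [e] once
     [routing_energy] is summed over all triples. *)
  pose supp I a J := transition_support P (theta I a J).
  pose load e := \sum_I \sum_a \sum_(J | (0 < khat I a J) && (e \in supp I a J))
    khat I a J * energy P (theta I a J).
  have load_le e : e \in edges P ->
      load e <= R_En P pi khat theta * capacity P pi e.
    (* Divided by the positive capacity, [load e] is one of the terms maximised in [R_En]. *)
    move=> eE; rewrite -ler_pdivrMr ?Q_gt0 // mulrC.
    exact: (le_bigmax_cond _ (fun e => (capacity P pi e)^-1 * load e)).
  apply: (@le_trans _ _ (\sum_(e in edges P) load e * edge_grad f e ^+ 2));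
    last first.
    rewrite mulr_sumr; apply: ler_sum => e eE; rewrite mulrA.
    by rewrite ler_wpM2r ?sqr_ge0 ?load_le.
  (* The sum over edges is moved innermost, reducing the claim to one triple at a time. *)
  under [leRHS]eq_bigr do rewrite mulr_suml.
  rewrite [leRHS]exchange_big /=; apply: ler_sum => I _.
  under [leLHS]eq_bigr do rewrite -khat_sum mulr_suml.
  under [leRHS]eq_bigr do rewrite mulr_suml.
  rewrite [leLHS]exchange_big [leRHS]exchange_big /=; apply: ler_sum => a _.
  under [leRHS]eq_bigr do rewrite mulr_suml.
  rewrite (exchange_big_dep (fun J => 0 < khat I a J)) /=; last first.
    by move=> e J _ /andP[].
  (* Triples of weight 0 are split off, since [theta] need not be a routing there; their
     contribution vanishes. *)
  rewrite (bigID (fun J => 0 < khat I a J)) /= [X in _ + X]big1 => [|J]; last first.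
    rewrite -leNgt => k0; have /eqP -> : khat I a J == 0; rewrite ?mul0r //.
    by rewrite eq_le k0 khat_ge0.
  rewrite addr0; apply: ler_sum => J kpos; rewrite -mulr_sumr -mulrA.
  rewrite ler_wpM2l // (eq_bigl (mem (supp I a J))) => [|e].
    exact: routing_energy (rt _ _ _ kpos).
  by rewrite kpos /=; apply: andb_idl; rewrite inE => /andP[].
(* Second inequality: the Dirichlet form, a nonnegative sum over edges, is cancelled. *)
rewrite ler_wpM2r //.
  by apply: sumr_ge0 => e /Q_gt0/ltW Q0; rewrite mulr_ge0 ?sqr_ge0.
have En_ge0 : 0 <= En_max P khat theta by apply: bigmax_ge_id.
apply: bigmax_le => [|e eE]; first by rewrite mulr_ge0 // bigmax_ge_id.
(* This [load] carries no energy factor: it is the one maximised in [rho_supp]. *)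
pose load e := \sum_I \sum_a
  \sum_(J | (0 < khat I a J) && (e \in transition_support P (theta I a J)))
    khat I a J.
apply: (@le_trans _ _ (En_max P khat theta * ((capacity P pi e)^-1 * load e)));
  last first.
  rewrite ler_wpM2l //.
  exact: (le_bigmax_cond _ (fun e => (capacity P pi e)^-1 * load e)).
rewrite mulrCA ler_wpM2l ?invr_ge0 ?(ltW (Q_gt0 _ eE)) // /load [leRHS]mulr_sumr.
apply: ler_sum => I _; rewrite [leRHS]mulr_sumr; apply: ler_sum => a _.
rewrite [leRHS]mulr_sumr; apply: ler_sum => J /andP[kpos _].
rewrite mulrC ler_wpM2r //.
(* The energy of one triple is bounded by the iterated maximum, one index at a time. *)
apply: le_trans (le_bigmax _ _ I); apply: le_trans (le_bigmax _ _ a).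
exact: (le_bigmax_cond _ (fun J => energy P (theta I a J))).
Qed.
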